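(* Let $k\ge 2$ be an integer and let $\mathcal{H}=(V,E)$ be a $k$-uniform and $(k+1)$-regular linear hypergraph. Then $\mathrm{q}(\mathcal{H})\le\Delta([\mathcal{H}]_2)+1$.
   Context: A hypergraph $\mathcal{H}=(V,E)$ consists of a finite nonempty set $V$ of vertices and a nonempty set $E$ of nonempty subsets of $V$, called hyperedges. The degree of a vertex $x\in V$ is $\deg_{\mathcal{H}}(x)=|\{a\in E: x\in a\}|$. $\mathcal{H}$ is $k$-uniform if $|e|=k$ for all $e\in E$, and $d$-regular if $\deg_{\mathcal{H}}(x)=d$ for all $x\in V$. $\mathcal{H}$ is linear if $|e\cap e'|\le 1$ for every pair of distinct hyperedges $e,e'\in E$. The 2-section of $\mathcal{H}$ is the loopless multigraph $[\mathcal{H}]_2$ with vertex set $V$ in which two distinct vertices $x,y$ are joined by exactly $m$ parallel edges, where $m$ is the number of hyperedges of $\mathcal{H}$ containing both $x$ and $y$ (it is a simple graph when $\mathcal{H}$ is linear). $\Delta([\mathcal{H}]_2)$ denotes its maximum degree. The chromatic index $\mathrm{q}(\mathcal{H})$ is the least integer $q$ such that there exists a map $c:E\to\{1,2,\dots,q\}$ satisfying: for all $e,e'\in E$, $c(e)=c(e')$ implies $e\cap e'=\varnothing$ or $e=e'$. *)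

(* Defs.v *)
From mathcomp Require Import all_boot.
Set Implicit Arguments.
Unset Strict Implicit.
Unset Printing Implicit Defensive.

Record hypergraph (V : finType) := Hypergraph {
  hyperedges : {set {set V}};
  vertices_nonempty : 0 < #|V|;
  hyperedges_nonempty : hyperedges != set0;
  hyperedge_nonempty : forall e, e \in hyperedges -> e != set0
}.

Definition hdeg (V : finType) (H : hypergraph V) (x : V) : nat :=
  #|[set a in hyperedges H | x \in a]|.

Definition uniform (V : finType) (k : nat) (H : hypergraph V) : Prop :=
  forall e, e \in hyperedges H -> #|e| = k.

Definition regular (V : finType) (d : nat) (H : hypergraph V) : Prop :=
  forall x, hdeg H x = d.

Definition linear (V : finType) (H : hypergraph V) : Prop :=
  forall e e', e \in hyperedges H -> e' \in hyperedges H -> e != e' ->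
  #|e :&: e'| <= 1.

(* A finite loopless multigraph, encoded by its edge multiplicities. *)
Record multigraph (V : finType) := Multigraph {
  mult : V -> V -> nat;
  mult_sym : forall x y, mult x y = mult y x;
  mult_loopless : forall x, mult x x = 0
}.

Definition mgdeg (V : finType) (G : multigraph V) (x : V) : nat :=
  \sum_(y : V) mult G x y.

Definition max_degree (V : finType) (G : multigraph V) : nat :=
  \max_(x : V) mgdeg G x.

Section TwoSection.
Variables (V : finType) (H : hypergraph V).

Definition codegree (x y : V) : nat :=
  if x == y then 0
  else #|[set e in hyperedges H | (x \in e) && (y \in e)]|.

Lemma codegree_sym x y : codegree x y = codegree y x.
Proof.
rewrite /codegree eq_sym; case: ifP => // _.
by apply: eq_card => e; rewrite !inE [(x \in e) && _]andbC.
Qed.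

Lemma codegree_loopless x : codegree x x = 0.
Proof. by rewrite /codegree eqxx. Qed.

Definition two_section : multigraph V :=
  Multigraph codegree_sym codegree_loopless.

End TwoSection.

Section ChromaticIndex.
Variables (V : finType) (H : hypergraph V).

Definition hyperedge : finType := {e : {set V} | e \in hyperedges H}.

Definition proper_coloring (q : nat) (c : {ffun hyperedge -> 'I_q}) : bool :=
  [forall e, forall e', (c e == c e') ==>
     ((val e :&: val e' == set0) || (e == e'))].

Definition edge_colorable (q : nat) : bool :=
  [exists c : {ffun hyperedge -> 'I_q}, proper_coloring c].

Lemma edge_colorable_ex : exists q, edge_colorable q.
Proof.
exists #|hyperedge|; apply/existsP; exists [ffun e => enum_rank e].
apply/forallP=> e; apply/forallP=> e'; apply/implyP.
by rewrite !ffunE => /eqP/enum_rank_inj->; rewrite eqxx orbT.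
Qed.

Definition chromatic_index : nat := ex_minn edge_colorable_ex.

End ChromaticIndex.

(* Main.v *)
(* The line graph of [H] has maximum degree at most [k * k], while the 2-section
   is [(k + 1)(k - 1)]-regular. Brooks' theorem then gives [k * k] colours, since a clique of size
   [k * k + 1] is excluded by a divisibility argument.

   Brooks' theorem is proved by induction on the set [S] to be coloured, after
   Zajac's "A short proof of Brooks' theorem". Start from a path [a - v - b]
   with [a], [b] nonadjacent, extend it beyond [b] to a maximal path, and let
   [C] be the cycle through its end point [y] and the farthest neighbour of [y]
   on the path. If some vertex of [C] has a neighbour [u] outside [C], there is
   such a vertex [z] next to a vertex [x] of [C] without one: colour [S \ C],
   give [x] the colour of [u], and colour greedily around [C] up to [z], which
   then has two neighbours of the same colour. Otherwise [C] is the whole path;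
   give [a] and [b] the same colour, and colour greedily towards [v]. *)

Require Import Defs.
From mathcomp Require Import all_boot.
From mathcomp Require Import zify.

(** Later isolates the neighbour of a path's end point that lies farthest along the path. *)
Lemma split_last_has {T : Type} (a : pred T) s : has a s ->
  exists s1 x s2, [/\ s = s1 ++ x :: s2, a x & ~~ has a s2].
Proof.
elim: s => //= x s IHs; have [/IHs[s1 [y [s2 [-> ay as2]]]] _|as' /orP[ax|//]] :=
  boolP (has a s).
  by exists (x :: s1), y, s2.
by exists [::], x, s.
Qed.

(** * Brooks' theorem: extending partial colourings *)

Section Brooks.

Variables (T : finType) (adj : rel T) (d : nat).
Hypothesis adj_sym : symmetric adj.
Hypothesis adj_irr : irreflexive adj.
Hypothesis adj_deg : forall x, #|[set y | adj x y]| <= d.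

Definition proper_on (c : T -> 'I_d) (A : {set T}) : Prop :=
  {in A &, forall x y, adj x y -> c x != c y}.

Lemma proper_onW c (A B : {set T}) :
  A \subset B -> proper_on c B -> proper_on c A.
Proof. by move=> /subsetP AB cB x y /AB xB /AB yB; apply: cB. Qed.

(** Counting the colours around [v], not its neighbours, covers both ways of saving a colour: an
    uncoloured neighbour, or two neighbours that share a colour. *)
Lemma proper_on_add c (A : {set T}) v :
    proper_on c A -> v \notin A -> #|c @: [set y in A | adj v y]| < d ->
  exists2 c', proper_on c' (v |: A) & {in A, c' =1 c}.
Proof.
move=> cA vA small.
have [a aP] : exists a, a \notin c @: [set y in A | adj v y].
  apply/existsP; rewrite -negb_forall; apply/negP => /forallP allc.
  suff : d <= #|c @: [set y in A | adj v y]| by lia.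
  by rewrite -{1}(card_ord d) subset_leq_card //; apply/subsetP.
have aN y : y \in A -> adj v y -> a != c y.
  move=> yA vy; apply: contraNneq aP => ->.
  by apply: imset_f; rewrite inE yA.
exists (fun y => if y == v then a else c y) => [x y|x xA]; last first.
  by case: eqP xA vA => // -> ->.
rewrite !inE; case: eqVneq => [->|_] /= xA; case: eqVneq => [->|_] /= yA.
- by rewrite adj_irr.
- exact: aN.
- by rewrite adj_sym eq_sym; apply: aN.
- exact: cA.
Qed.

Lemma proper_on_add_free c (A : {set T}) v w :
    proper_on c A -> v \notin A -> w \notin A -> adj v w ->
  exists2 c', proper_on c' (v |: A) & {in A, c' =1 c}.
Proof.
move=> cA vA wA vw; apply: proper_on_add => //.
apply: leq_ltn_trans (leq_imset_card _ _) _.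
apply: leq_trans (adj_deg v); apply: proper_card; apply/properP; split.
  by apply/subsetP => y; rewrite !inE => /andP[].
by exists w; rewrite !inE // (negPf wA).
Qed.

(** Dropping [b] from the coloured neighbours of [v] loses no colour, since [a] keeps it; so at most
    [d - 1] colours are blocked. *)
Lemma proper_on_add_twins c (A : {set T}) v a b :
    proper_on c A -> v \notin A -> a \in A -> b \in A -> a != b ->
    adj v a -> adj v b -> c a = c b ->
  exists2 c', proper_on c' (v |: A) & {in A, c' =1 c}.
Proof.
move=> cA vA aA bA ab va vb cab; apply: proper_on_add => //.
set B := [set y in A | adj v y].
have bB : b \in B by rewrite inE bA.
have -> : c @: B = c @: (B :\ b).
  apply/eqP; rewrite eqEsubset (imsetS c (subD1set _ _)) andbT.
  apply/subsetP => _ /imsetP[y yB ->].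
  have [->|yb] := eqVneq y b; last by apply: imset_f; rewrite in_setD1 yb.
  by rewrite -cab; apply: imset_f; rewrite in_setD1 ab inE aA.
apply: leq_ltn_trans (leq_imset_card _ _) _.
apply: leq_trans (adj_deg v).
apply: leq_trans (_ : #|B| <= _); first by rewrite [X in _ <= X](cardsD1 b) bB.
by apply: subset_leq_card; apply/subsetP => y; rewrite !inE => /andP[].
Qed.

(* The path is coloured from its far end, so that every vertex still has an
   uncoloured neighbour (its predecessor) when its turn comes. *)
Lemma proper_on_path c (A : {set T}) w s :
    path adj w s -> uniq (w :: s) -> {in w :: s, forall x, x \notin A} ->
    proper_on c A ->
  exists2 c', proper_on c' (A :|: [set x in s]) & {in A, c' =1 c}.
Proof.
elim: s w => [|x s IHs] w /=.
  move=> _ _ _ cA; exists c => //; apply: proper_onW cA.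
  by apply/subsetP => y; rewrite !inE orbF.
move=> /andP[wx xs] /andP[wNxs uxs] wxsA cA.
have [|c1 c1P c1E] := IHs x xs uxs _ cA.
  by move=> y ys; apply: wxsA; rewrite inE ys orbT.
have [wA xA] : w \notin A /\ x \notin A.
  by split; apply: wxsA; rewrite !inE eqxx ?orbT.
move: wNxs; rewrite inE negb_or => /andP[wNx wNs].
have [|||c2 c2P c2E] := proper_on_add_free _ _ x w c1P.
- by rewrite !inE negb_or xA; case/andP: uxs.
- by rewrite !inE negb_or wA.
- by rewrite adj_sym.
exists c2 => [|y yA]; last by rewrite c2E ?c1E // inE yA.
apply: proper_onW c2P; apply/subsetP => y; rewrite !inE.
by case: (y \in A); case: (y == x).
Qed.

(** As [x] has no neighbour in [A], it may copy the colour of [u]. Then [q] is coloured from its end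
    next to [x] back towards [z], which comes last and sees the twins [x] and [u]. *)
Lemma proper_on_cycle c (A : {set T}) z q x u :
    path adj z (rcons q x) -> adj x z -> uniq (z :: rcons q x) ->
    {in z :: rcons q x, forall y, y \notin A} ->
    u \in A -> adj z u -> {in A, forall y, ~~ adj x y} -> proper_on c A ->
  exists c', proper_on c' (A :|: [set y in z :: rcons q x]).
Proof.
move=> zq xz uzq zqA uA zu xA cA.
have xNA : x \notin A by apply: zqA; rewrite inE mem_rcons inE eqxx orbT.
have zNA : z \notin A by apply: zqA; rewrite inE eqxx.
move: uzq; rewrite /= mem_rcons inE negb_or rcons_uniq.
case/and3P => /andP[zNx zNq] xNq uq.
pose c0 y := if y == x then c u else c y.
have c0E : {in A, c0 =1 c}.
  by move=> y yA; rewrite /c0; case: eqP => // yx; rewrite -yx yA in xNA.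
have c0P : proper_on c0 (x |: A).
  move=> y y'; rewrite !in_setU1.
  have [->|yx] := eqVneq y x => yA; have [->|y'x] := eqVneq y' x => y'A yy'.
  - by rewrite adj_irr in yy'.
  - by rewrite (negPf (xA _ y'A)) in yy'.
  - by rewrite adj_sym (negPf (xA _ yA)) in yy'.
  - by rewrite !c0E //; apply: cA.
have [|||c1 c1P c1E] := proper_on_path _ _ z q _ _ _ c0P.
- by move: zq; rewrite rcons_path => /andP[].
- by rewrite /= zNq.
- move=> y yzq; rewrite in_setU1 negb_or zqA.
    by rewrite andbT; apply: contraNneq xNq => yx; move: yzq; rewrite yx inE eq_sym (negPf zNx).
  by move: yzq; rewrite !inE mem_rcons inE => /orP[->|->]; rewrite ?orbT.
have [|||||||c2 c2P _] := proper_on_add_twins _ _ z x u c1P.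
- by rewrite !inE negb_or negb_or zNx zNA.
- by rewrite !inE eqxx.
- by rewrite !inE uA orbT.
- by apply: contraNneq xNA => ->.
- by rewrite adj_sym.
- by [].
- by rewrite (c1E x) ?setU11 // (c1E u) ?(setU1r _ uA) // (c0E u) // /c0 eqxx.
exists c2; apply: proper_onW c2P; apply/subsetP => y; rewrite !inE mem_rcons inE.
by case: (y \in A); case: (y == z); case: (y == x).
Qed.

(** The order is [a] and [b] with a common colour, then [q2] back towards [m], then [q1] forwards up
    to [m], and finally [v]. The chord from [v] to [m] leaves each vertex an uncoloured neighbour
    until [v], which has the twins [a] and [b]. *)
Lemma proper_on_hub c (A : {set T}) q1 m q2 a b v :
    sorted adj (q1 ++ m :: q2 ++ [:: b; v; a]) ->
    uniq (q1 ++ m :: q2 ++ [:: b; v; a]) ->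
    {in q1 ++ m :: q2 ++ [:: b; v; a], forall x, x \notin A} ->
    {in A, forall x, ~~ adj a x /\ ~~ adj b x} ->
    ~~ adj a b -> adj v m -> 0 < d -> proper_on c A ->
  exists c', proper_on c' (A :|: [set x in q1 ++ m :: q2 ++ [:: b; v; a]]).
Proof.
set s := q1 ++ _ => ss us sA abA ab vm d_gt0 cA.
have [q1m mq2] : sorted adj (rcons q1 m) /\ path adj m (q2 ++ [:: b; v; a]).
  split; last by case: (cat_sorted2 ss).
  by move: ss; rewrite /s -cat_rcons => /cat_sorted2[].
move: mq2; rewrite cat_path /= => /and5P[mq2 _ bv va _].
(* The blocks on the right are the stages of the colouring, last stage first. *)
have perm : perm_eq s ((v :: m :: rev q1) ++ q2 ++ [:: a; b]).
  apply/permP => p; rewrite /s /= !count_cat /= !count_cat count_rev /=.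
  move: (count p q1) (count p q2) (p m : nat) (p a : nat) (p b : nat) (p v : nat).
  by lia.
have smem := perm_mem perm.
have aA : a \notin A by apply: sA; rewrite smem !(inE, mem_cat) eqxx !orbT.
have bA : b \notin A by apply: sA; rewrite smem !(inE, mem_cat) eqxx !orbT.
move: us; rewrite (perm_uniq perm) !cat_uniq => /and3P[uv vN].
case/and3P => uq2 q2N /andP[aNb _].
have abN x : x \in v :: m :: rev q1 -> [/\ x != a, x != b & x \notin q2].
  move=> xv; split; apply: contraNN vN => x2; apply/hasP; exists x => //.
  - by rewrite mem_cat inE x2 orbT.
  - by rewrite mem_cat !inE x2 !orbT.
  - by rewrite mem_cat x2.
have q2ab x : x \in q2 -> x != a /\ x != b.
  move=> xq; split; apply: contraNneq q2N => xE; apply/hasP; exists x => //.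
    by rewrite xE inE eqxx.
  by rewrite xE !inE eqxx orbT.
pose c0 y := if (y == a) || (y == b) then Ordinal d_gt0 else c y.
have c0P : proper_on c0 (A :|: [set a; b]).
  have freeA x y : x \in A -> y \in [set a; b] -> ~~ adj y x.
    by move=> /abA[aNx bNx]; rewrite !inE => /orP[]/eqP->.
  have out x : x \in A -> (x == a) || (x == b) = false.
    by apply: contraTF => /orP[]/eqP->.
  move=> x y /setUP[xA|xab] /setUP[yA|yab] xy.
  - by rewrite /c0 !out //; apply: cA.
  - by rewrite adj_sym (negPf (freeA _ _ xA yab)) in xy.
  - by rewrite (negPf (freeA _ _ yA xab)) in xy.
  - move: xab yab xy; rewrite !inE.
    by do 2![case/orP => /eqP->]; rewrite ?adj_irr ?[adj b a]adj_sym ?(negPf ab).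
have mv : m \in v :: m :: rev q1 by rewrite !inE eqxx orbT.
have [||c1 c1P c1E] := proper_on_path _ _ m q2 mq2 _ _ c0P.
- by rewrite /= uq2 andbT; case: (abN _ mv).
- move=> x; rewrite !inE !negb_or => /predU1P[->|xq2].
    by rewrite sA ?smem ?mem_cat ?mv //; case: (abN _ mv) => -> ->.
  by rewrite sA ?smem ?mem_cat ?xq2 ?orbT //; case: (q2ab _ xq2) => -> ->.
have [||c2 c2P c2E] := proper_on_path _ _ v (m :: rev q1) _ uv _ c1P.
- rewrite /= vm /=; case: (q1) q1m => // x p xp.
  rewrite rev_cons -[path _ _ _]/(sorted adj (m :: rcons (rev p) x)).
  rewrite -rev_cons -rev_rcons rev_sorted.
  by rewrite (eq_sorted (e' := adj)) // => y z; rewrite adj_sym.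
- move=> x xv; have [xa xb xq2] := abN x xv.
  rewrite !inE (negPf xa) (negPf xb) (negPf xq2) !orbF.
  by rewrite sA // smem mem_cat xv.
have vv : v \in v :: m :: rev q1 by rewrite inE eqxx.
have [va' vb' vq2] := abN v vv.
have c2ab x : x \in [set a; b] -> c2 x = Ordinal d_gt0.
  move=> xab; have xA1 : x \in A :|: [set a; b] by rewrite inE xab orbT.
  rewrite (c2E x (subsetP (subsetUl _ _) _ xA1)) (c1E x xA1) /c0.
  by move: xab; rewrite !inE => ->.
have [|||||||c3 c3P _] := proper_on_add_twins _ _ v a b c2P.
- rewrite !inE !negb_or va' vb' vq2 sA ?smem ?mem_cat ?vv //=.
  by case/andP: uv; rewrite inE negb_or.
- by rewrite !inE eqxx !orbT.
- by rewrite !inE eqxx !orbT.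
- by move: aNb; rewrite inE.
- by [].
- by rewrite adj_sym.
- by rewrite !c2ab // !inE eqxx ?orbT.
exists c3; apply: proper_onW c3P; apply/subsetP => x.
rewrite in_setU inE smem !(inE, mem_cat).
by do ![case: (_ \in _) | case: (_ == _)].
Qed.

(** * Brooks' theorem: maximal paths and the induction *)

Lemma maximal_path_extension (S : {set T}) t :
    t != [::] -> sorted adj t -> uniq t -> {subset t <= S} ->
  exists q y p, [/\ q ++ t = y :: p, sorted adj (y :: p), uniq (y :: p),
    {subset y :: p <= S} & {in S, forall z, adj y z -> z \in p}].
Proof.
have [n] := ubnP (#|S| - size t); elim: n t => // n IHn [//|y p] ltn _ st ut tS.
have [|maxy] := boolP [exists z in S, adj y z && (z \notin p)]; last first.
  exists [::], y, p; split=> // z zS yz; apply: contraNT maxy => zp.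
  by apply/existsP; exists z; rewrite zS yz.
case/existsP => z /and3P[zS yz zp].
have uzt : uniq (z :: y :: p).
  by rewrite cons_uniq ut inE negb_or zp !andbT; apply: contraTneq yz => ->; rewrite adj_irr.
have ztS : {subset z :: y :: p <= S}.
  by move=> x; rewrite inE => /predU1P[->//|]; apply: tS.
have szt : size (z :: y :: p) <= #|S|.
  by rewrite -(card_uniqP uzt) subset_leq_card //; apply/subsetP.
have [|||q [y' [p' [E H1 H2 H3 H4]]]] := IHn (z :: y :: p) _ _ _ uzt ztS.
- by move: ltn szt => /=; lia.
- by [].
- by move: st; rewrite /= adj_sym yz.
by exists (rcons q z), y', p'; split=> //; rewrite cat_rcons.
Qed.

Theorem brooks_on : 3 <= d ->
    (forall K : {set T}, {in K &, forall x y, x != y -> adj x y} -> #|K| <= d) ->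
  forall S : {set T}, exists c, proper_on c S.
Proof.
move=> d_ge3 noclique S; have d_gt0 : 0 < d by lia.
have [n] := ubnP #|S|; elim: n S => // n IHn S ltSn.
have IHS (A : {set T}) : A \proper S -> exists c, proper_on c A.
  by move=> /proper_card AS; apply: IHn; lia.
have [->|[v vS]] := set_0Vmem S.
  by exists (fun=> Ordinal d_gt0) => x y; rewrite inE.
(* A vertex with fewer than [d] neighbours in [S] can be coloured last. *)
have [small|big] := ltnP #|[set y in S | adj v y]| d.
  have [c cP] := IHS _ (properD1 vS).
  have [||c' c'P _] := proper_on_add c (S :\ v) v cP.
  - by rewrite !inE eqxx.
  - apply: leq_ltn_trans (leq_imset_card _ _) _; apply: leq_ltn_trans small.
    by apply: subset_leq_card; apply/subsetP => y; rewrite !inE => /andP[/andP[_ ->]].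
  by exists c'; rewrite setD1K in c'P.
set N := [set y in S | adj v y] in big.
have [a [b [aN bN ab nab]]] :
    exists a b, [/\ a \in N, b \in N, a != b & ~~ adj a b].
  have [/exists_inP[a aN /exists_inP[b bN /andP[ab nab]]]|clique] :=
    boolP [exists a in N, [exists b in N, (a != b) && ~~ adj a b]].
    by exists a, b.
  (* If [N] were a clique, [v] and [N] would form one with more than [d] vertices. *)
  suff : #|v |: N| <= d by rewrite cardsU1 inE adj_irr andbF /=; lia.
  apply: noclique => x y /setU1P[->|xN] /setU1P[->|yN] xy.
  - by rewrite eqxx in xy.
  - by move: yN; rewrite inE => /andP[].
  - by move: xN; rewrite inE adj_sym => /andP[].
  apply: contraNT clique => nxy; apply/exists_inP; exists x => //.
  by apply/exists_inP; exists y => //; rewrite xy.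
move: (aN) (bN); rewrite !inE => /andP[aS va] /andP[bS vb].
have [va' vb'] : v != a /\ v != b.
  by split; [apply: contraTneq va|apply: contraTneq vb] => <-; rewrite adj_irr.
have [||||q [y [p [E sp up pS pmax]]]] :=
  maximal_path_extension S [:: b; v; a].
- by [].
- by rewrite /= va [adj b v]adj_sym vb.
- by rewrite /= !inE negb_or [b == v]eq_sym vb' [b == a]eq_sym ab va'.
- by move=> x; rewrite !inE => /or3P[]/eqP->.
have [|p1 [x0 [p2 [pE yx0 yp2]]]] := split_last_has (adj y) p.
  case: (p) E sp => [|x p'] Ep /=; last by case/andP=> ->.
  by move/(congr1 size): Ep; rewrite size_cat addn3.
pose C := y :: rcons p1 x0.
have CE : y :: p = C ++ p2 by rewrite pE /C /= cat_rcons.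
have [sC uC] : sorted adj C /\ uniq C.
  split; first by move: sp; rewrite CE => /cat_sorted2[].
  by move: up; rewrite CE cat_uniq => /andP[].
have CS x : x \in C -> x \in S by move=> xC; apply: pS; rewrite CE mem_cat xC.
pose A := S :\: [set x in C].
have inA x : (x \in A) = (x \notin C) && (x \in S) by rewrite !inE.
have CNA x : x \in C -> x \notin A by rewrite inA => ->.
have [c cA] : exists c, proper_on c A.
  apply: IHS; apply/properP; split; first exact: subsetDl.
  by exists y; [apply: CS|apply: CNA]; rewrite inE eqxx.
have SAC : S \subset A :|: [set x in C].
  by apply/subsetP => x xS; rewrite !inE xS andbT orNb.
pose out x := [exists u in A, adj x u].
(* By maximality every neighbour of [y] in [S] lies on [p], and none comes after [x0]. *)
have yNout : ~~ out y.
  apply/exists_inP => -[u]; rewrite inA => /andP[uNC uS] yu.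
  have := pmax u uS yu; rewrite pE -cat_rcons mem_cat => /orP[up1|up2].
    by rewrite /C inE up1 orbT in uNC.
  by case/hasP: yp2; exists u.
have [outC|noout] := boolP (has out C).
  have cC : cycle adj C.
    by rewrite /C [cycle _ _]rcons_path last_rcons [adj x0 y]adj_sym yx0 andbT.
  (* Generalising [C] lets [split_find] cut it at its first vertex [z] with a neighbour in [A]. The
     [head] equation shows that [z] is not [y], so [z] has a predecessor [x]; the cycle is then
     rotated to run from [z] to [x]. *)
  move: (C) outC uC cC CNA SAC yNout (erefl : head y C = y).
  move=> C'; case/split_find => z r q2 zout rNout.
  case/lastP: r rNout => [|r x].
    by move=> _ _ _ _ _ /= + zy; rewrite -zy zout.
  rewrite has_rcons negb_or => /andP[xNout _] uC' cC' CNA' SAC' _ _.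
  move: zout => /exists_inP[u uA zu].
  have perm : perm_eq (rcons (rcons r x) z ++ q2) (z :: rcons (q2 ++ r) x).
    by rewrite cat_rcons perm_catC rcons_cat.
  have cyc : cycle adj (z :: rcons (q2 ++ r) x).
    by rewrite rcons_cat -cat_cons -rot_size_cat rot_cycle -cat_rcons.
  move: cyc; rewrite /= rcons_path last_rcons => /andP[zx xz].
  have [|||c' c'P] := proper_on_cycle c A z (q2 ++ r) x u zx xz _ _ uA zu _ cA.
  - by rewrite -(perm_uniq perm).
  - by move=> w wC; apply: CNA'; rewrite (perm_mem perm).
  - by move=> w wA; apply: contraNN xNout => xw; apply/exists_inP; exists w.
  exists c'; apply: proper_onW c'P; apply: subset_trans SAC' _.
  by apply/subsetP => w; rewrite !in_setU !in_set (perm_mem perm).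
have NoutC x u : x \in C -> u \in A -> ~~ adj x u.
  move=> xC uA; apply: contraNN noout => xu; apply/hasP; exists x => //.
  by apply/exists_inP; exists u.
(* Otherwise the first vertex of [p2] would be a neighbour of [x0] in [A]. *)
have p20 : p2 = [::].
  case: p2 CE {pE yp2} => // w p2 CE.
  have wA : w \in A.
    rewrite inA pS ?CE ?mem_cat ?inE ?eqxx ?orbT // andbT.
    move: up; rewrite CE cat_uniq => /and3P[_ + _].
    by apply: contraNN => wC; apply/hasP; exists w; rewrite ?mem_head.
  have x0C : x0 \in C by rewrite inE mem_rcons inE eqxx orbT.
  have := NoutC x0 w x0C wA.
  move: sp; rewrite CE /C cat_cons cat_rcons /= cat_path /=.
  by case/and3P => _ _ /andP[->].
have qE : C = q ++ [:: b; v; a] by rewrite E CE p20 cats0.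
have vC : v \in C by rewrite qE mem_cat !inE eqxx !orbT.
(* [N] has at least [d >= 3] elements, so [v] has a neighbour besides [a] and [b]. No edge joins [C]
   to [A], which places it on [C], hence on [q]. *)
have [m mN] : exists m, m \in N :\ a :\ b.
  have cardD1 x (B : {set T}) : #|B| <= #|B :\ x|.+1.
    by rewrite [X in X <= _](cardsD1 x) addnC -addn1 leq_add2l leq_b1.
  apply/set0Pn; rewrite -card_gt0 -(ltn_add2r 2) addn2.
  apply: leq_trans d_ge3 (leq_trans big _); apply: leq_trans (cardD1 a N) _.
  by rewrite addn2 ltnS cardD1.
move: mN; rewrite !inE => /and4P[mb ma mS vm].
have mq : m \in q.
  have : m \in C by apply: contraTT vm => mC; apply: NoutC; rewrite // inA mC.
  rewrite qE mem_cat !inE (negPf mb) (negPf ma) orbF.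
  by case: (eqVneq m v) vm => [->|]; rewrite ?adj_irr ?orbF.
case/splitPr: mq qE => q1 q2; rewrite -catA cat_cons => qE.
have [||||||||c' c'P] := proper_on_hub c A q1 m q2 a b v; rewrite -?qE //.
- by move=> x xA; split; apply: NoutC; rewrite // qE !(mem_cat, inE) eqxx !orbT.
by exists c'; apply: proper_onW c'P; rewrite -qE.
Qed.

End Brooks.

(** * Degrees in the 2-section *)

Lemma mgdeg_two_section (V : finType) (H : hypergraph V) k d x :
  uniform k H -> regular d H -> mgdeg (two_section H) x = d * k.-1.
Proof.
move=> Hunif Hreg; rewrite /mgdeg /=.
(* Removing [x] from [e] makes the diagonal term vanish. After exchanging sums, each hyperedge
   through [x] contributes [k.-1]. *)
have codegE y :
    codegree H x y = \sum_(e in hyperedges H | x \in e) (y \in e :\ x).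
  rewrite /codegree; have [<-|xy] := eqVneq x y.
    by rewrite big1 // => e _; rewrite !inE eqxx.
  rewrite -sum1_card [LHS](eq_bigl (fun e => (e \in hyperedges H) && (x \in e)
      && (y \in e))); last by move=> e; rewrite inE andbA.
  rewrite big_mkcondr; apply: eq_bigr => e _.
  by rewrite !inE eq_sym xy; case: (y \in e).
under eq_bigr => y _ do rewrite codegE.
rewrite exchange_big /= -(Hreg x) /hdeg -sum_nat_const.
rewrite [RHS](eq_bigl (fun e => (e \in hyperedges H) && (x \in e))); last first.
  by move=> e; rewrite inE.
apply: eq_bigr => e /andP[eE xe].
rewrite -(Hunif e eE) (cardsD1 x e) xe /= -sum1_card [RHS]big_mkcond /=.
by apply: eq_bigr => y _; case: (_ \in _).
Qed.

(** * The line graph: degrees and cliques *)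

Section LineGraph.

Variables (V : finType) (H : hypergraph V) (k : nat).
Hypotheses (Hunif : uniform k H) (Hreg : regular k.+1 H).

(** The relation lives on all vertex sets; those that are not hyperedges are isolated. *)
Definition line_adj (e f : {set V}) : bool :=
  [&& e \in hyperedges H, f \in hyperedges H, e != f & e :&: f != set0].

Lemma line_adj_sym : symmetric line_adj.
Proof. by move=> e f; rewrite /line_adj andbCA eq_sym setIC. Qed.

Lemma line_adj_irr : irreflexive line_adj.
Proof. by move=> e; rewrite /line_adj eqxx !andbF. Qed.

(** The neighbours of [e] are covered by [k] stars, one per vertex of [e], each with [k] hyperedges
    other than [e]. *)
Lemma line_adj_deg e : #|[set f | line_adj e f]| <= k * k.
Proof.
have [eE|eNE] := boolP (e \in hyperedges H); last first.
  by rewrite (_ : [set f | _] = set0) ?cards0 //; apply/setP => f;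
     rewrite !inE /line_adj (negPf eNE).
pose star x := [set f in hyperedges H | x \in f] :\ e.
have starE x : x \in e -> #|star x| = k.
  move=> xe; have := Hreg x; rewrite /hdeg (cardsD1 e) inE eE xe add1n.
  by case.
have -> : k * k = \sum_(x in e) #|star x|.
  by rewrite (eq_bigr _ starE) sum_nat_const (Hunif _ eE).
apply: leq_trans (_ : #|\bigcup_(x in e) star x| <= _).
  apply: subset_leq_card; apply/subsetP => f; rewrite inE => /and4P[_ fE ef].
  case/set0Pn => x /setIP[xe xf]; apply/bigcupP; exists x => //.
  by rewrite !inE eq_sym ef fE.
elim/big_rec2: _ => [|x m B _ le]; first by rewrite cards0.
by apply: leq_trans (leq_card_setU _ _) _; rewrite leq_add2l.
Qed.

(* A clique of size [k * k + 1] would be closed under adjacency, so counting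
   its incidences would give [k.+1 %| k * (k * k + 1)], whereas
   [k * (k * k + 1) = - 2] modulo [k.+1]. *)
Lemma line_clique (K : {set {set V}}) :
  2 <= k -> {in K &, forall e f, e != f -> line_adj e f} -> #|K| <= k * k.
Proof.
move=> k_ge2 clique; rewrite leqNgt; apply/negP => big.
(* [K :\ e] already has [k * k] elements, the maximum degree, so it is the whole neighbourhood of
   [e]. *)
have nbrs e : e \in K -> [set f | line_adj e f] = K :\ e.
  move=> eK; apply/esym/eqP; rewrite eqEcard; apply/andP; split.
    apply/subsetP => f; rewrite !inE => /andP[fe fK].
    by apply: clique; rewrite // eq_sym.
  apply: leq_trans (line_adj_deg e) _.
  by move: big; rewrite (cardsD1 e K) eK.
have [e0 e0K] : exists e0, e0 \in K by apply/set0Pn; rewrite -card_gt0; apply: leq_ltn_trans big.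
have cardK : #|K| = (k * k).+1.
  apply/eqP; rewrite eqn_leq big andbT (cardsD1 e0) e0K -nbrs //.
  exact: line_adj_deg.
have KE e : e \in K -> e \in hyperedges H.
  move=> eK; have /set0Pn[f] : K :\ e != set0.
    rewrite -card_gt0; have := cardsD1 e K; rewrite eK cardK add1n => -[<-].
    by rewrite muln_gt0 andbb; apply: leq_trans k_ge2.
  by rewrite -nbrs // inE => /andP[].
(* Incidences are counted twice. By [nbrs], all [k.+1] hyperedges through a covered vertex belong to
   [K]. *)
have count : #|K| * k = #|cover K| * k.+1.
  rewrite -!sum_nat_const.
  transitivity (\sum_(e in K) \sum_(x in cover K) (x \in e)).
    apply: eq_bigr => e eK; rewrite -(Hunif _ (KE e eK)) -sum1_card.
    rewrite [LHS]big_mkcond [RHS]big_mkcond /=; apply: eq_bigr => x _.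
    have [xe|xNe] := boolP (x \in e); last by case: ifP.
    by rewrite (_ : x \in cover K) //; apply/bigcupP; exists e.
  rewrite exchange_big; apply: eq_bigr => x /bigcupP[e eK xe].
  rewrite -(Hreg x) /hdeg -sum1_card [LHS]big_mkcond [RHS]big_mkcond /=.
  apply: eq_bigr => f _; rewrite inE.
  have [fK|fNK] := boolP (f \in K); first by rewrite KE //; case: (x \in f).
  case: ifP => // /andP[fE xf]; case/negP: fNK.
  have [->//|fe] := eqVneq f e.
  suff : f \in K :\ e by case/setD1P.
  rewrite -nbrs // inE /line_adj KE // fE eq_sym fe.
  by apply/set0Pn; exists x; rewrite inE xe.
have : k.+1 %| #|K| * k + 2.
  rewrite cardK (_ : _ + 2 = (k * k - k + 2) * k.+1) ?dvdn_mull //.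
  by clear -k_ge2; nia.
rewrite dvdn_addr; last by rewrite count dvdn_mull.
by move/dvdn_leq => /(_ isT); rewrite ltnNge k_ge2.
Qed.

End LineGraph.

(** * The bound on the chromatic index *)

Theorem theorem2 (V : finType) (H : hypergraph V) (k : nat) (hk : 2 <= k)
    (Hunif : uniform k H) (Hreg : regular k.+1 H) (Hlin : linear H) :
  chromatic_index H <= max_degree (two_section H) + 1.
Proof.
have [x0 _] : exists x0, x0 \in V.
  by have /card_gt0P[x0 x0V] := vertices_nonempty H; exists x0.
apply: (@leq_trans (k * k)); last first.
  apply: leq_trans (_ : mgdeg (two_section H) x0 + 1 <= _); last first.
    by rewrite leq_add2r; apply: leq_bigmax.
  (* Here [(k + 1) * (k - 1) + 1 = k * k], exactly the degree bound of the line graph. *)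
  rewrite (mgdeg_two_section _ _ _ _ x0 Hunif Hreg).
  by clear -hk; nia.
rewrite /chromatic_index; case: ex_minnP => q _; apply.
have [c cP] : exists c : {set V} -> 'I_(k * k),
    proper_on _ (line_adj V H) (k * k) c setT.
  apply: brooks_on.
  - exact: line_adj_sym.
  - exact: line_adj_irr.
  - exact: line_adj_deg.
  - by apply: leq_trans (leq_mul hk hk).
  - by move=> K; apply: line_clique.
apply/existsP; exists [ffun e => c (val e)].
apply/forallP => e; apply/forallP => f; rewrite !ffunE.
apply/implyP => ce; apply: contraLR ce; rewrite negb_or => /andP[ef enf].
by apply: cP; rewrite ?inE // /line_adj (valP e) (valP f) ef andbT.
Qed.
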